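(* For every boolean function $f:\{0,1\}^n\to\{0,1\}$, \[ \mathrm{bs}(f)^2 - \mathrm{bs}(f) \leq \tfrac{2}{3}\left(\deg(f)^4 - \deg(f)^2\right), \] and hence \[ \mathrm{bs}(f) \leq \sqrt{2/3}\cdot \deg(f)^2 + 1. \]
   Context: For $x\in\{0,1\}^n$ and $S\subseteq[n]$, $x^S$ denotes $x$ with the bits in $S$ flipped. The block sensitivity $\mathrm{bs}_x(f)$ is the maximum $k$ such that there exist pairwise disjoint sets $B_1,\dots,B_k\subseteq[n]$ with $f(x)\neq f(x^{B_i})$ for all $i$; $\mathrm{bs}(f)=\max_x \mathrm{bs}_x(f)$. $\deg(f)$ is the degree of the unique multilinear real polynomial agreeing with $f$ on $\{0,1\}^n$. *)

(* Defs.v *)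
From mathcomp Require Import all_boot all_order all_algebra.
From mathcomp Require Import reals.
From mathcomp Require Import mpoly.

Set Implicit Arguments.
Unset Strict Implicit.
Unset Printing Implicit Defensive.

Import Order.TTheory GRing.Theory Num.Theory.
Local Open Scope ring_scope.

Notation cube n := {ffun 'I_n -> bool}.

Section BlockSensitivity.

Variable n : nat.
Implicit Types (f : cube n -> bool) (x : cube n) (S : {set 'I_n}).

Definition flip x S : cube n := [ffun i => x i (+) (i \in S)].

(* A block B with f x != f (flip x B) is nonempty, so pairwise disjoint such  *)
(* blocks are distinct: a set P of sets loses nothing over a list B_1, ..,    *)
(* B_k (see bs_atP).                                                          *)
Definition bs_at f x : nat :=
  (\max_(P : {set {set 'I_n}} |
         trivIset P && [forall B in P, f x != f (flip x B)]) #|P|)%N.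

Definition bs f : nat := (\max_(x : cube n) bs_at f x)%N.

Lemma flip0 x : flip x set0 = x.
Proof. by apply/ffunP=> i; rewrite ffunE inE addbF. Qed.

Lemma bs_atP f x k :
  reflect (exists B : 'I_k -> {set 'I_n},
             (forall i j, i != j -> [disjoint B i & B j]) /\
             (forall i, f x != f (flip x (B i))))
          (k <= bs_at f x)%N.
Proof.
pose good (P : {set {set 'I_n}}) :=
  trivIset P && [forall B in P, f x != f (flip x B)].
have good0 : good set0.
  rewrite /good; apply/andP; split; first by apply/trivIsetP => A B; rewrite inE.
  by apply/forall_inP => B; rewrite inE.
apply: (iffP idP) => [|[B [dB sB]]].
  rewrite /bs_at (bigop.bigmax_eq_arg set0) //.
  case: arg_maxnP => // P /andP[/trivIsetP tP /forall_inP sP] _ lekP.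
  exists (fun i => enum_val (widen_ord lekP i)); split=> [i j neij|i].
    apply: tP; rewrite ?enum_valP //; apply: contra neij => /eqP/enum_val_inj.
    by move/(congr1 val)=> /= /val_inj ->.
  by apply: sP; rewrite enum_valP.
have injB : injective B.
  move=> i j eqB; apply/eqP; apply/negPn/negP => /dB.
  rewrite eqB -setI_eq0 setIid => /eqP B0.
  by have := sB j; rewrite B0 flip0 eqxx.
pose P : {set {set 'I_n}} := [set B i | i : 'I_k].
have -> : k = #|P| by rewrite card_imset // card_ord.
apply: (bigop.leq_bigmax_cond P); apply/andP; split.
  apply/trivIsetP => _ _ /imsetP[i _ ->] /imsetP[j _ ->] neB.
  by apply: dB; apply: contra neB => /eqP ->.
by apply/forall_inP => _ /imsetP[i _ ->].
Qed.

End BlockSensitivity.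

Section Degree.

Variables (R : realType) (n : nat).
Implicit Types (f : cube n -> bool) (x : cube n) (p q : {mpoly R[n]}).

Definition multilinear p : bool :=
  all (fun m : 'X_{1..n} => [forall i, m i <= 1]%N) (msupp p).

Definition agrees_on_cube p f : bool :=
  [forall x : cube n, p.@[fun i => (x i)%:R] == (f x)%:R].

Definition represents p f : bool := multilinear p && agrees_on_cube p f.

Let bounded p (d : 'I_n -> nat) :=
  forall m, m \in msupp p -> forall j, (m j <= d j)%N.

Let boundedM p q d e :
  bounded p d -> bounded q e -> bounded (p * q) (fun j => d j + e j)%N.
Proof.
move=> bp bq m /msuppM_le /allpairsP[[m1 m2] /= [m1p m2q ->]] j.
by rewrite mnmDE leq_add ?bp ?bq.
Qed.

Let bounded_factor (b : bool) i :
  bounded (if b then 'X_i else 1 - 'X_i) (fun j => (i == j) : nat).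
Proof.
move=> m; case: b => [|/msuppB_le].
  by rewrite msuppX inE => /eqP-> j; rewrite mnm1E.
rewrite mem_cat msuppX -[1]/(1%:MP) msupp1 !inE.
by case/orP=> /eqP-> j; rewrite ?mnm0E ?mnm1E.
Qed.

Let indic x : {mpoly R[n]} := \prod_i (if x i then 'X_i else 1 - 'X_i).

Let bounded_indic x : bounded (indic x) (fun=> 1%N).
Proof.
have H (r : seq 'I_n) :
    bounded (\prod_(i <- r) (if x i then 'X_i else 1 - 'X_i))
            (fun j => \sum_(i <- r) (i == j))%N.
  elim: r => [|i r IH].
    move=> m; rewrite big_nil -[1]/(1%:MP) msupp1 inE => /eqP-> j.
    by rewrite mnm0E.
  move=> m; rewrite big_cons => mS j; rewrite big_cons.
  exact: (boundedM (@bounded_factor (x i) i) IH).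
move=> m mS j; apply: leq_trans (H _ m mS j) _.
rewrite (bigD1_seq j) ?mem_index_enum ?index_enum_uniq //= eqxx big1 //.
by move=> i /negPf->.
Qed.

Let eval_indic x (y : cube n) : (indic x).@[fun i => (y i)%:R] = (x == y)%:R.
Proof.
rewrite rmorph_prod /=; have [<-|neq] := eqVneq x y.
  apply: big1 => i _; case xi: (x i); first by rewrite mevalXU xi.
  by rewrite mevalB meval1 mevalXU xi subr0.
have [i nei] : exists i, x i != y i.
  apply/existsP; apply: contraR neq => /existsPn H.
  by apply/eqP/ffunP => i; apply/eqP; rewrite -[_ == _]negbK.
rewrite (bigD1 i) //=; case xi: (x i) nei; case yi: (y i) => // _.
  by rewrite mevalXU yi mul0r.
by rewrite mevalB meval1 mevalXU yi subrr mul0r.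
Qed.

Lemma represents_ex f : exists p, represents p f.
Proof.
exists (\sum_(x : cube n | f x) indic x); apply/andP; split.
  apply/allP => m /msupp_sum_le /flattenP[s /mapP[x _ ->] mS].
  by apply/forallP => j; apply: bounded_indic mS j.
apply/forallP => y; rewrite raddf_sum /=.
under eq_bigr do rewrite eval_indic.
case fy: (f y).
  rewrite (bigD1 y) //= eqxx big1 ?addr0 // => x /andP[_ /negPf->] //.
by rewrite big1 // => x fx; case: eqVneq => // eqxy; rewrite eqxy fy in fx.
Qed.

Lemma represents_uniq f p q : represents p f -> represents q f -> p = q.
Proof.
move=> /andP[/allP mp /forallP ep] /andP[/allP mq /forallP eq].
apply/eqP; rewrite -subr_eq0; set r := p - q.
have mr m : m \in msupp r -> forall i, (m i <= 1)%N.
  by move/msuppB_le; rewrite mem_cat => /orP[/mp|/mq] /forallP.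
have er (x : cube n) : r.@[fun i => (x i)%:R] = 0.
  by rewrite mevalB (eqP (ep x)) (eqP (eq x)) subrr.
apply/negPn/negP => r0.
have exd : exists d, has (fun m => mdeg m == d) (msupp r).
  by exists (mdeg (mlead r)); apply/hasP; exists (mlead r); rewrite ?mlead_supp.
case: (ex_minnP exd) => d /hasP[m mS /eqP md] mind.
pose x : cube n := [ffun i => m i == 1%N].
have := er x; rewrite mevalE (bigD1_seq m) //= ?msupp_uniq //.
rewrite [X in _ * X]big1 ?mulr1 => [|i _]; last first.
  by rewrite ffunE; have := mr _ mS i; case: (m i) => [|[]] //= _; rewrite expr1n.
rewrite big_seq_cond big1 => [|m' /andP[m'S nem]].
  by move/eqP; rewrite addr0; apply/negP; rewrite -mcoeff_msupp.
have [le|] := boolP [forall i, (m' i <= m i)%N]; last first.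
  case/forallPn=> i; rewrite -ltnNge => lti.
  rewrite (bigD1 i) //= ffunE.
  have mi0 : m i = 0%N.
    by apply/eqP; rewrite -leqn0 -ltnS (leq_trans lti) // mr.
  have -> : m' i = 1%N by apply/eqP; rewrite eqn_leq mr // (leq_trans _ lti).
  by rewrite mi0 expr1 mul0r mulr0.
have lem : (m' <= m)%MM by apply/mnm_lepP => i; apply: (forallP le).
have /mind : has (fun m0 => mdeg m0 == mdeg m') (msupp r).
  by apply/hasP; exists m'.
rewrite -md -(submK lem) mdegD -{2}[mdeg m']add0n leq_add2r leqn0 mdeg_eq0.
move=> /eqP mm0; case/negP: nem; apply/eqP.
by rewrite -[RHS](submK lem) mm0 add0m.
Qed.

Definition multilinear_poly f : {mpoly R[n]} := xchoose (represents_ex f).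

Lemma multilinear_polyP f : represents (multilinear_poly f) f.
Proof. exact: xchooseP (represents_ex f). Qed.

(* msize is the total degree plus one, and 0 for the zero polynomial, whose   *)
(* degree is thus 0.                                                          *)
Definition bdeg f : nat := (msize (multilinear_poly f)).-1.

End Degree.

Arguments multilinear_poly R {n} f.
Arguments bdeg R {n} f.

(* Main.v *)
Require Import Defs.
From mathcomp Require Import all_boot all_order all_algebra.
From mathcomp Require Import ring lra.
From mathcomp Require Import reals trigo mpoly.

Set Implicit Arguments.
Unset Strict Implicit.
Unset Printing Implicit Defensive.

Import Order.TTheory GRing.Theory Num.Theory.
Local Open Scope ring_scope.

(* At a point x where bs(f) = k is attained by disjoint blocks B_1, .., B_k, let
   P(t) be the probability that f changes its value when each block is flipped
   independently with probability t. Then P has degree at most deg(f), maps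
   [0, 1] to [0, 1], and P(0) = 0. Each single block changes f, so the second
   coefficient of P is at most -k(k-1) + k(k-1)/2, i.e. P''(0) <= -(k^2 - k).
   V. A. Markov's inequality for the second derivative at an endpoint bounds
   |P''(0)| by 2 T_d''(1) = 2/3 (d^4 - d^2); it follows from Lagrange
   interpolation at the extrema cos(j pi / d) of the Chebyshev polynomial T_d. *)

(** * Chebyshev polynomials of the first kind *)

Section Chebyshev.

Variable R : comNzRingType.

(** Carries T_n and T_(n+1) together, making the two-step recurrence structural. *)
Fixpoint chebyshev_pair n : {poly R} * {poly R} :=
  if n is n'.+1 then
    let: (p, q) := chebyshev_pair n' in (q, 2 *: ('X * q) - p)
  else (1, 'X).

Definition chebyshev n : {poly R} := (chebyshev_pair n).1.

Lemma chebyshev0 : chebyshev 0 = 1. Proof. by []. Qed.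

Lemma chebyshev1 : chebyshev 1 = 'X. Proof. by []. Qed.

Lemma chebyshevSS n :
  chebyshev n.+2 = 2 *: ('X * chebyshev n.+1) - chebyshev n.
Proof. by rewrite /chebyshev /=; case: (chebyshev_pair n). Qed.

Lemma chebyshev_ind (P : nat -> Prop) :
  P 0%N -> P 1%N -> (forall n, P n -> P n.+1 -> P n.+2) -> forall n, P n.
Proof.
move=> P0 P1 PSS n; suff [] : P n /\ P n.+1 by [].
by elim: n => [|n [IHn IHn1]]; split=> //; apply: PSS.
Qed.

Lemma size_chebyshev n : (size (chebyshev n) <= n.+1)%N.
Proof.
elim/chebyshev_ind: n => [||n IHn IHn1]; rewrite ?size_poly1 ?size_polyX //.
rewrite chebyshevSS (leq_trans (size_polyD _ _)) // geq_max size_polyN.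
rewrite (leq_trans IHn) ?andbT; last by rewrite -addn2 leq_addr.
rewrite (leq_trans (size_scale_leq _ _)) // (leq_trans (size_polyMleq _ _)) //.
by rewrite size_polyX.
Qed.

Lemma horner1_chebyshev n : (chebyshev n).[1] = 1.
Proof.
elim/chebyshev_ind: n => [||n IHn IHn1]; rewrite ?hornerC ?hornerX //.
by rewrite chebyshevSS !(hornerD, hornerN, hornerZ, hornerM, hornerX) IHn
           IHn1; ring.
Qed.

Lemma horner1_deriv_chebyshev n : (chebyshev n)^`().[1] = n%:R ^+ 2.
Proof.
elim/chebyshev_ind: n => [||n IHn IHn1].
- by rewrite chebyshev0 -polyC1 derivC horner0 expr0n.
- by rewrite chebyshev1 derivX hornerC expr1n.
rewrite chebyshevSS derivB derivZ derivM derivX.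
rewrite !(hornerD, hornerN, hornerZ, hornerM, hornerX, hornerC) IHn IHn1.
by rewrite horner1_chebyshev -(addn2 n) -(addn1 n) !natrD; ring.
Qed.

End Chebyshev.

Arguments chebyshev {R} n.

(** Differentiating the recurrence twice expresses T_(n+2)''(1) through T_(n+1)''(1), T_n''(1) and
    T_(n+1)'(1) = (n+1)^2. *)
Lemma horner1_derivn2_chebyshev (F : numFieldType) n :
  (@chebyshev F n)^`(2).[1] = (n%:R ^+ 4 - n%:R ^+ 2) / 3.
Proof.
elim/chebyshev_ind: n => [||n IHn IHn1].
- by rewrite chebyshev0 -polyC1 derivnC horner0 !expr0n subrr mul0r.
- by rewrite chebyshev1 /= derivX derivC horner0 !expr1n subrr mul0r.
rewrite chebyshevSS !derivnS derivn0 !derivE.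
rewrite !(hornerD, hornerN, hornerZ, hornerM, hornerX, hornerC).
rewrite -[_^`()^`()]/(derivn 2 _) in IHn IHn1 *.
rewrite IHn1 -[(chebyshev n)^`()^`()]/(derivn 2 _) IHn !horner1_deriv_chebyshev.
by rewrite -(addn2 n) -(addn1 n) !natrD; field.
Qed.

Lemma chebyshev_cos (R : realType) n (a : R) :
  (chebyshev n).[cos a] = cos (n%:R * a).
Proof.
elim/chebyshev_ind: n => [||n IHn IHn1].
- by rewrite hornerC mul0r cos0.
- by rewrite hornerX mul1r.
rewrite chebyshevSS !(hornerD, hornerN, hornerZ, hornerM, hornerX) IHn IHn1.
have -> : n%:R * a = n.+1%:R * a - a by rewrite -(addn1 n) natrD; ring.
have -> : n.+2%:R * a = n.+1%:R * a + a by rewrite -(addn1 n.+1) natrD; ring.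
by rewrite cosB cosD; ring.
Qed.

Lemma cos_natpi (R : realType) n : cos (n%:R * pi) = (-1) ^+ n :> R.
Proof.
elim: n => [|n IHn]; first by rewrite mul0r cos0.
by rewrite -addn1 natrD mulrDl mul1r cosDpi IHn exprD mulrN1.
Qed.

(** * Lagrange interpolation and comparison of second derivatives *)

Section Lagrange.

Variables (F : fieldType) (n : nat) (x : 'I_n -> F).
Hypothesis x_inj : injective x.

Definition lagrange_num (j : 'I_n) : {poly F} :=
  \prod_(i | i != j) ('X - (x i)%:P).

Definition lagrange_den (j : 'I_n) : F := \prod_(i | i != j) (x j - x i).

Lemma horner_lagrange_num i j :
  (lagrange_num j).[x i] = lagrange_den j *+ (i == j).
Proof.
rewrite horner_prod; have [->|neij] := eqVneq i j.
  by apply: eq_bigr => k _; rewrite hornerXsubC.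
by rewrite (bigD1 i) //= hornerXsubC subrr mul0r.
Qed.

Lemma lagrange_den_neq0 j : lagrange_den j != 0.
Proof.
apply/prodf_neq0 => i; rewrite subr_eq0; apply: contra => /eqP/x_inj ->.
exact: eqxx.
Qed.

Lemma size_lagrange_num j : (size (lagrange_num j) <= n)%N.
Proof.
rewrite /lagrange_num -big_filter size_prod_XsubC.
have [e _ _ [_ ->]] := big_enumP; have -> : #|[pred i | i != j]| = n.-1.
  by rewrite -[in RHS](card_ord n) -(cardC1 j); apply: eq_card.
by case: n j => [[]|].
Qed.

(** The difference of the two sides has size at most [n] and vanishes at [n] distinct nodes. *)
Lemma lagrange_interpolation (p : {poly F}) : (size p <= n)%N ->
  p = \sum_j (p.[x j] / lagrange_den j) *: lagrange_num j.
Proof.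
move=> size_p; apply/eqP; rewrite -subr_eq0; apply/eqP.
apply: (@roots_geq_poly_eq0 _ _ [seq x i | i <- enum 'I_n]).
- apply/allP => _ /mapP[i _ ->]; rewrite rootE hornerD hornerN horner_sum.
  rewrite (bigD1 i) //= big1 => [|j neji]; last first.
    by rewrite hornerZ horner_lagrange_num eq_sym (negPf neji) mulr0.
  rewrite hornerZ horner_lagrange_num eqxx mulr1n divfK ?lagrange_den_neq0 //.
  by rewrite addr0 subrr.
- by rewrite map_inj_uniq ?enum_uniq.
rewrite size_map size_enum_ord (leq_trans (size_polyD _ _)) // geq_max size_p.
rewrite size_polyN (leq_trans (size_sum _ _ _)) //; apply/bigmax_leqP => j _.
exact: leq_trans (size_scale_leq _ _) (size_lagrange_num j).
Qed.

End Lagrange.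

(** By induction on the factors: the product rule keeps the value and the first two derivatives at
    [a] nonnegative together. *)
Lemma prod_XsubC_derivn2_ge0 (R : realDomainType) (I : Type) (r : seq I)
    (P : pred I) (x : I -> R) (a : R) : (forall i, P i -> x i <= a) ->
  0 <= (\prod_(i <- r | P i) ('X - (x i)%:P))^`(2).[a].
Proof.
move=> le_xa; set p := \prod_(i <- r | P i) _.
suff [] : [/\ 0 <= p.[a], 0 <= p^`().[a] & 0 <= p^`()^`().[a]] by [].
rewrite {}/p; elim/big_rec: _ => [|i p Pi [p0 p1 p2]].
  by rewrite -polyC1 derivC deriv0 !hornerC ler01; split.
have := derivXsubC (x i); have : 0 <= ('X - (x i)%:P).[a].
  by rewrite hornerXsubC subr_ge0 le_xa.
move: ('X - _) => q q0 dq.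
rewrite !(derivM, derivD, dq, mul1r) !(hornerD, hornerM).
by split; repeat (apply: addr_ge0 || apply: mulr_ge0).
Qed.

(* Each Lagrange basis polynomial has all its roots at most [a], so the sign of
   its second derivative at [a] is that of its denominator; since the nodes
   decrease, these signs alternate exactly as the values of [t] do. *)
Lemma derivn2_le_alternating (R : realFieldType) n (x : 'I_n -> R) (a : R)
    (p t : {poly R}) :
  {homo x : i j / (i < j)%N >-> j < i} -> (forall i, x i <= a) ->
  (size p <= n)%N -> (size t <= n)%N ->
  (forall i, `|p.[x i]| <= 1) -> (forall i, t.[x i] = (-1) ^+ i) ->
  `|p^`(2).[a]| <= t^`(2).[a].
Proof.
move=> x_decr le_xa size_p size_t p_le1 t_alt.
have x_inj : injective x.
  move=> i j eqx; apply/val_inj; case: (ltngtP i j) => // /x_decr.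
    by rewrite eqx ltxx.
  by rewrite eqx ltxx.
have den_sign (j : 'I_n) : 0 < (-1) ^+ j / lagrange_den x j.
  (* One factor -1 for each i < j, matching the negative factors [x j - x i] of the denominator. *)
  have -> : (-1) ^+ j =
      \prod_(i < n | i != j) (if (i < j)%N then -1 else 1) :> R.
    rewrite -big_mkcondr -{1}(card_ord j) -prodr_const.
    rewrite (big_ord_widen n (fun=> -1)) ?(ltnW (ltn_ord j)) //.
    by apply: eq_bigl => i; rewrite ltn_neqAle andbA andbb.
  rewrite -prodfV -big_split /=; apply: prodr_gt0 => i neij.
  case: ltngtP => [ltij|ltji|/val_inj eqij]; last by rewrite eqij eqxx in neij.
    by rewrite mulN1r oppr_gt0 invr_lt0 subr_lt0 x_decr.
  by rewrite mul1r invr_gt0 subr_gt0 x_decr.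
have num_ge0 j : 0 <= (lagrange_num x j)^`(2).[a].
  exact: prod_XsubC_derivn2_ge0.
have expand (q : {poly R}) : (size q <= n)%N ->
    q^`(2).[a] =
      \sum_j q.[x j] / lagrange_den x j * (lagrange_num x j)^`(2).[a].
  move=> size_q; rewrite {1}(lagrange_interpolation x_inj size_q).
  rewrite raddf_sum horner_sum; apply: eq_bigr => j _.
  by rewrite /= !derivZ hornerZ.
rewrite (expand p) // (expand t) // (le_trans (ler_norm_sum _ _ _)) //.
apply: ler_sum => j _; rewrite t_alt !normrM (ger0_norm (num_ge0 j)).
rewrite ler_wpM2r // -[leRHS]gtr0_norm // normrM ler_wpM2r //.
by rewrite normrX normrN1 expr1n.
Qed.

(** * V. A. Markov's inequality for the second derivative at an endpoint *)

Section Markov.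

Variable R : realType.

(** The [d.+1] nodes cos(i pi / d) decrease from 1 to -1, and T_d takes the value (-1)^i at the
    i-th. *)
Lemma derivn2_at1_le (p : {poly R}) d : (0 < d)%N -> (size p <= d.+1)%N ->
  (forall t, -1 <= t <= 1 -> `|p.[t]| <= 1) ->
  `|p^`(2).[1]| <= (d%:R ^+ 4 - d%:R ^+ 2) / 3.
Proof.
move=> d_gt0 size_p p_le1; rewrite -horner1_derivn2_chebyshev.
have d0 : 0 < d%:R :> R by rewrite ltr0n.
have pi0 := pi_gt0 R.
have in_0pi (i : 'I_d.+1) : i%:R * pi / d%:R \in `[0 : R, pi].
  rewrite in_itv /= !mulr_ge0 ?invr_ge0 ?pi_ge0 //= ler_pdivrMr // mulrC.
  by rewrite ler_pM2l // ler_nat -ltnS.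
apply: (@derivn2_le_alternating _ d.+1 (fun i => cos (i%:R * pi / d%:R))) => //.
- move=> i j ltij; rewrite ltr_cos ?in_0pi // ltr_pM2r ?invr_gt0 //.
  by rewrite ltr_pM2r // ltr_nat.
- by move=> i; apply: cos_le1.
- exact: size_chebyshev.
- by move=> i; rewrite p_le1 // cos_geN1 cos_le1.
move=> i; rewrite chebyshev_cos -cos_natpi; congr cos.
by rewrite mulrC divfK ?gt_eqF.
Qed.

Lemma coef2_unit_range_le (p : {poly R}) d : (size p <= d.+1)%N ->
  (forall t, 0 <= t <= 1 -> 0 <= p.[t] <= 1) ->
  `|p`_2| *+ 2 <= 2 / 3 * (d%:R ^+ 4 - d%:R ^+ 2).
Proof.
case: d => [|d] size_p p_01.
  (* In degree 0, where the nodes would divide by 0, [p] is constant and both sides vanish. *)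
  rewrite nth_default ?(leq_trans size_p) // normr0 mul0rn.
  by rewrite !expr0n subrr mulr0.
pose h : {poly R} := 2^-1 *: (1 - 'X).
pose q := 2 *: (p \Po h) - 1.
have size_h : (size h <= 2)%N.
  rewrite (leq_trans (size_scale_leq _ _)) // (leq_trans (size_polyD _ _)) //.
  by rewrite size_polyN size_polyX size_poly1.
have hE t : h.[t] = 2^-1 * (1 - t).
  by rewrite /h hornerZ hornerD hornerN hornerX hornerC.
have q_le1 t : -1 <= t <= 1 -> `|q.[t]| <= 1.
  move=> t11; rewrite /q hornerD hornerN hornerZ horner_comp hornerC hE.
  have : 0 <= 2^-1 * (1 - t) <= 1 by lra.
  by move=> /p_01; rewrite ler_norml; lra.
have size_q : (size q <= d.+2)%N.
  rewrite (leq_trans (size_polyD _ _)) // geq_max size_polyN size_poly1 andbT.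
  rewrite (leq_trans (size_scale_leq _ _)) //.
  rewrite (leq_trans (size_comp_poly_leq _ _)) //.
  rewrite ltnS (leq_trans (leq_mul (leqnn _) (_ : _ <= 1)%N)) ?muln1 //.
    by case: (size h) size_h => [|[|[]]].
  by case: (size p) size_p.
(* Chain rule: q''(1) = 2 (1/2)^2 p''(0), and p''(0) is twice the coefficient. *)
have q2 : q^`(2).[1] = p`_2.
  have dh : h^`() = (- 2^-1)%:P.
    by rewrite /h derivZ derivB derivX -polyC1 derivC sub0r -polyCN -mul_polyC
               -polyCM mulrN1.
  rewrite /q -polyC1 !derivnS derivn0 derivB derivC subr0 derivZ deriv_comp dh.
  rewrite derivZ derivM derivC mulr0 addr0 deriv_comp dh.
  rewrite hornerZ !hornerM !hornerC.
  rewrite horner_comp hE subrr mulr0 horner_coef0 !coef_deriv mulr1n -mulr_natr.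
  by field.
have := derivn2_at1_le (ltn0Sn d) size_q q_le1; rewrite q2 mulr2n; lra.
Qed.

End Markov.

(** * Probabilities of random sets as polynomials *)

Section BernsteinWeight.

Variables (R : comNzRingType) (k : nat).
Implicit Type A : {set 'I_k}.

(* The probability of the set A when each of its elements is drawn
   independently with probability 'X. *)
Definition draw_weight A : {poly R} :=
  \prod_j (if j \in A then 'X else 1 - 'X).

Lemma draw_weightE A : draw_weight A = 'X ^+ #|A| * (1 - 'X) ^+ (k - #|A|).
Proof.
rewrite /draw_weight (bigID (mem A)) /=; congr (_ * _).
  by rewrite -prodr_const; apply: eq_bigr => j ->.
rewrite (eq_bigr (fun=> 1 - 'X)) => [|j /negPf->//].
rewrite prodr_const; congr (_ ^+ _).
have := cardC (mem A); rewrite card_ord => /(canRL (addKn _)) <-.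
by apply: eq_card => j.
Qed.

(** Expanding the product of [k] factors X + (1 - X) gives one term for each set. *)
Lemma sum_draw_weight : \sum_A draw_weight A = 1.
Proof.
rewrite -(bigA_distr _ _ (fun=> 'X) (fun=> 1 - 'X)) big1 // => j _.
exact: subrKC.
Qed.

Lemma coef_expr1subX m : ((1 - 'X : {poly R}) ^+ m)`_0 = 1 /\
  ((1 - 'X : {poly R}) ^+ m)`_1 = - m%:R.
Proof.
elim: m => [|m [IH0 IH1]]; first by rewrite expr0 !coefC oppr0.
rewrite exprS mulrBl mul1r !coefB !coefXM /= IH0 IH1 subr0; split=> //.
by rewrite -addn1 natrD opprD.
Qed.

(** A singleton contributes the linear coefficient of (1 - X)^(k-1), a pair the constant coefficient
    of (1 - X)^(k-2). *)
Lemma coef2_draw_weight A : (0 < #|A|)%N ->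
  (draw_weight A)`_2 = (#|A| == 2)%:R - (k.-1)%:R *+ (#|A| == 1).
Proof.
move=> A0; rewrite draw_weightE coefXnM.
case: #|A| A0 => [|[|[|m]]] //= _; rewrite ?subnn ?(coef_expr1subX _).1.
- by rewrite (coef_expr1subX _).2 subn1 sub0r mulr1n.
- by rewrite subr0.
by rewrite subr0.
Qed.

End BernsteinWeight.

Arguments draw_weight {R k} A.

Lemma draw_weight_ge0 (R : realDomainType) k (A : {set 'I_k}) (t : R) :
  0 <= t <= 1 -> 0 <= (draw_weight A).[t].
Proof.
case/andP=> t0 t1; rewrite draw_weightE hornerM !horner_exp hornerX.
by rewrite mulr_ge0 ?exprn_ge0 // hornerD hornerN hornerC hornerX subr_ge0.
Qed.

(** * Mean of a boolean function of a random set *)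

Section DrawMean.

Variables (R : realFieldType) (k : nat) (g : {set 'I_k} -> bool).

Definition draw_mean : {poly R} := \sum_A (g A)%:R *: draw_weight A.

(** On [0, 1] the weights are nonnegative and sum to 1, so this averages values 0 and 1. *)
Lemma draw_mean_unit_range (t : R) : 0 <= t <= 1 -> 0 <= draw_mean.[t] <= 1.
Proof.
move=> t01; rewrite /draw_mean horner_sum; apply/andP; split.
  by apply: sumr_ge0 => A _; rewrite hornerZ mulr_ge0 ?draw_weight_ge0.
rewrite -[leRHS](hornerC 1 t) polyC1 -(sum_draw_weight R k) horner_sum.
apply: ler_sum => A _; rewrite hornerZ ler_piMl ?draw_weight_ge0 //.
by case: (g A).
Qed.

(* With value 0 on the empty set and 1 on the singletons, the singletons
   contribute -k(k-1) and the pairs at most k(k-1)/2. *)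
Lemma coef2_draw_mean_le : g set0 = false -> (forall j, g [set j]) ->
  draw_mean`_2 *+ 2 <= - (k%:R ^+ 2 - k%:R).
Proof.
move=> g0 g1; rewrite /draw_mean coef_sum.
apply: (@le_trans _ _ ((\sum_(A : {set 'I_k})
    ((#|A| == 2)%:R - (k.-1)%:R *+ (#|A| == 1))) *+ 2)).
  rewrite lerMn2r; apply/orP; right; apply: ler_sum => A _; rewrite coefZ.
  have [/eqP|A0] := posnP #|A|.
    by rewrite cards_eq0 => /eqP->; rewrite g0 mul0r cards0 subr0.
  rewrite coef2_draw_weight //.
  case: (boolP (#|A| == 1%N)) => [/cards1P[j ->]|_].
    by rewrite g1 mul1r.
  (* From two elements on, the coefficient is 0 or 1, so replacing [g A] by 1 cannot decrease the
     term. *)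
  by rewrite subr0; case: (g A); case: (_ == _); rewrite ?mul1r ?mul0r.
have count m : \sum_(A : {set 'I_k}) (#|A| == m)%:R = 'C(k, m)%:R :> R.
  rewrite -[in RHS](card_ord k) -card_draws -sum1_card natr_sum.
  by rewrite [RHS]big_mkcond; apply: eq_bigr => A _; rewrite inE; case: eqP.
rewrite sumrB count; under [X in _ - X]eq_bigr do rewrite -mulr_natr.
rewrite -mulr_sumr count bin1 mulrnBl -natrM.
have -> : 'C(k, 2)%:R *+ 2 = (k * k.-1)%:R :> R.
  by rewrite -mulrnA muln2 -mul2n mul_bin_left subn1 bin1 mulnC.
(* The case k = 0 is apart because [k.-1] truncates there. *)
case: k => [|m]; first by rewrite mul0n mul0rn expr0n !subrr oppr0.
by rewrite !natrM -!natr1 mulr2n; lra.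
Qed.

End DrawMean.

(** * Degree of the mean under random block flips *)

Section Blocks.

Variables (R : realType) (n k : nat) (f : {ffun 'I_n -> bool} -> bool).
Variables (x : {ffun 'I_n -> bool}) (B : 'I_k -> {set 'I_n}).
Hypothesis disjB : forall i j, i != j -> [disjoint B i & B j].

Definition flip_blocks (A : {set 'I_k}) := flip x (\bigcup_(j in A) B j).

Lemma mem_bigcup_block (A : {set 'I_k}) i j :
  i \in B j -> (i \in \bigcup_(l in A) B l) = (j \in A).
Proof.
move=> iBj; apply/bigcupP/idP => [[l lA iBl]|jA]; last by exists j.
have [<-//|/disjB /pred0P /(_ i) /=] := eqVneq l j.
by rewrite iBl iBj.
Qed.

Lemma notin_bigcup_block (A : {set 'I_k}) i :
  i \notin \bigcup_j B j -> i \notin \bigcup_(l in A) B l.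
Proof.
by apply: contra => /bigcupP[j _ iBj]; apply/bigcupP; exists j.
Qed.

Lemma prod_over_blocks (S : comNzRingType) (F : 'I_n -> S) :
  \prod_i F i =
    \prod_(i in ~: \bigcup_j B j) F i * \prod_j \prod_(i in B j) F i.
Proof.
rewrite (bigID (mem (\bigcup_j B j))) /= mulrC; congr (_ * _).
  by apply: eq_bigl => i; rewrite in_setC.
by apply: partition_disjoint_bigcup => i j; apply: disjB.
Qed.

(* The mean of a monomial factors over the blocks, and only the blocks that the
   monomial meets give a nonconstant (linear) factor. *)
Lemma size_draw_monomial (m : 'X_{1..n}) :
  (size (\sum_(A : {set 'I_k})
     (\prod_i ((flip_blocks A i)%:R : R) ^+ m i) *: draw_weight A)%R
   <= (mdeg m).+1)%N.
Proof.
(* [c] collects the coordinates outside all blocks, [h b j] those of block [j], flipped when [b]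
   holds. *)
pose c : R := \prod_(i in ~: \bigcup_j B j) ((x i)%:R : R) ^+ m i.
pose h b j : R := \prod_(i in B j) ((x i (+) b)%:R : R) ^+ m i.
have -> : \sum_(A : {set 'I_k})
     (\prod_i ((flip_blocks A i)%:R : R) ^+ m i) *: draw_weight A =
   c *: \prod_j (h true j *: 'X + h false j *: (1 - 'X)).
  rewrite (bigA_distr _ _ (fun j => h true j *: 'X)
             (fun j => h false j *: (1 - 'X))).
  rewrite scaler_sumr; apply: eq_bigr => A _; rewrite prod_over_blocks.
  rewrite -scalerA; congr (_ *: _).
    apply: eq_bigr => i; rewrite in_setC => /(notin_bigcup_block A)/negPf iA.
    by rewrite ffunE iA addbF.
  rewrite /draw_weight -scaler_prod; apply: eq_bigr => j _.
  have -> : \prod_(i in B j) ((flip_blocks A i)%:R : R) ^+ m i = h (j \in A) j.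
    by apply: eq_bigr => i iBj; rewrite ffunE (mem_bigcup_block A iBj).
  by case: ifP.
rewrite (leq_trans (size_scale_leq _ _)) //.
rewrite (leq_trans (size_poly_prod_leq _ _)) //.
have size_factor j :
    (size (h true j *: 'X + h false j *: (1 - 'X))%R
     <= (\sum_(i in B j) m i).+1)%N.
  have [mB0|mB0] := posnP (\sum_(i in B j) m i)%N.
    have h1 b : h b j = 1.
      apply: big1 => i iBj; move/eqP: mB0; rewrite sum_nat_eq0.
      by move/forall_inP/(_ i iBj)/eqP->.
    by rewrite !h1 !scale1r addrC subrK size_poly1.
  rewrite (leq_trans (size_polyD _ _)) // geq_max.
  rewrite !(leq_trans (size_scale_leq _ _)) // ?size_polyX //.
  rewrite (leq_trans (size_polyD _ _)) // geq_max.
  by rewrite size_polyN size_polyX size_poly1.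
(* The size bound for a product subtracts the number [k] of factors, which cancels the successor in
   each [size_factor]. *)
rewrite leq_subLR addnS ltnS mdegE.
rewrite (leq_trans (leq_sum _ (fun j _ => size_factor j))) //.
under eq_bigr do rewrite -add1n.
rewrite big_split /= sum1_card leq_add2l.
rewrite -(partition_disjoint_bigcup _ (fun i => m i)); last exact: disjB.
by rewrite [leqRHS](bigID (mem (\bigcup_j B j))) leq_addr.
Qed.

(** By linearity of the mean, [f] reduces to the monomials of its multilinear polynomial. *)
Lemma size_draw_mean_flip :
  (size (draw_mean R (fun A => f (flip_blocks A))) <= (bdeg R f).+1)%N.
Proof.
rewrite /draw_mean /bdeg; set p := multilinear_poly R f.
have /andP[_ /forallP pf] : represents p f := multilinear_polyP R f.
have -> : \sum_A (f (flip_blocks A))%:R *: draw_weight A =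
    \sum_(m <- msupp p) p@_m *: \sum_(A : {set 'I_k})
     (\prod_i ((flip_blocks A i)%:R : R) ^+ m i) *: draw_weight A.
  under [RHS]eq_bigr do rewrite scaler_sumr.
  rewrite exchange_big; apply: eq_bigr => A _.
  rewrite -(eqP (pf (flip_blocks A))) mevalE scaler_suml.
  by apply: eq_bigr => m _; rewrite scalerA.
rewrite big_seq (leq_trans (size_sum _ _ _)) //.
apply/bigmax_leqP_seq => m _ mp.
rewrite (leq_trans (size_scale_leq _ _)) //.
rewrite (leq_trans (size_draw_monomial m)) //.
by have := msize_mdeg_lt mp; case: (msize p).
Qed.

(** The indicator of a change is [f] when [f x] is false and 1 - f otherwise; subtracting from 1
    keeps the degree bound. *)
Lemma size_draw_mean_sensitive :
  (size (draw_mean R (fun A => f x != f (flip_blocks A))) <= (bdeg R f).+1)%N.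
Proof.
have size_f := size_draw_mean_flip; case fx: (f x); last first.
  rewrite (_ : draw_mean _ _ = draw_mean R (fun A => f (flip_blocks A))) //.
  by apply: eq_bigr => A _; case: (f _).
have -> : draw_mean R (fun A => true != f (flip_blocks A)) =
          1 - draw_mean R (fun A => f (flip_blocks A)).
  rewrite -(sum_draw_weight R k) -sumrB; apply: eq_bigr => A _.
  by case: (f _); rewrite ?scale0r ?scale1r ?subrr ?subr0.
by rewrite (leq_trans (size_polyD _ _)) // geq_max size_polyN size_poly1.
Qed.

End Blocks.

(** * The bounds on block sensitivity *)

Lemma bs_deg_quadratic (R : realType) n (f : {ffun 'I_n -> bool} -> bool) :
  (bs f)%:R ^+ 2 - (bs f)%:R <=
    2 / 3 * ((bdeg R f)%:R ^+ 4 - (bdeg R f)%:R ^+ 2) :> R.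
Proof.
have cube_gt0 : (0 < #|{: {ffun 'I_n -> bool}}|)%N.
  by apply/card_gt0P; exists [ffun=> false].
have [x bs_x] := bigop.eq_bigmax (bs_at f) cube_gt0.
have /bs_atP[B [disjB sensB]] : (bs f <= bs_at f x)%N by rewrite -bs_x.
pose g A := f x != f (flip_blocks x B A).
have g0 : g set0 = false by rewrite /g /flip_blocks big_set0 flip0 eqxx.
have g1 j : g [set j] by rewrite /g /flip_blocks big_set1.
have size_P := size_draw_mean_sensitive R f x disjB.
(* With P the mean of [g] and k = bs(f), it remains that k^2 - k <= -2 P_2 <= 2 |P_2|. *)
apply: le_trans (coef2_unit_range_le size_P (@draw_mean_unit_range R _ g)).
have := coef2_draw_mean_le R g0 g1; have := ler_norm (- (draw_mean R g)`_2).
by rewrite normrN !mulr2n; lra.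
Qed.

Theorem theorem8 (R : realType) (n : nat) (f : {ffun 'I_n -> bool} -> bool) :
  ((bs f)%:R ^+ 2 - (bs f)%:R <=
     2 / 3 * ((bdeg R f)%:R ^+ 4 - (bdeg R f)%:R ^+ 2) :> R)
  /\
  ((bs f)%:R <= Num.sqrt (2 / 3) * (bdeg R f)%:R ^+ 2 + 1 :> R).
Proof.
have quad := bs_deg_quadratic R f; split=> //.
set b : R := (bs f)%:R in quad *; set d : R := (bdeg R f)%:R in quad *.
have s0 : 0 <= Num.sqrt (2 / 3) * d ^+ 2.
  by rewrite mulr_ge0 ?sqrtr_ge0 ?sqr_ge0.
have s2 : (Num.sqrt (2 / 3) * d ^+ 2) ^+ 2 = 2 / 3 * d ^+ 4.
  by rewrite exprMn sqr_sqrtr ?divr_ge0 // -exprM.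
have := sqr_ge0 d; move: (Num.sqrt _ * _) s0 s2 => s s0 s2 d2.
(* If b > s + 1, then b^2 - b > (s + 1) s >= s^2 = 2/3 d^4, contradicting [quad]. *)
rewrite leNgt; apply/negP => sb; nra.
Qed.
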